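(* Let $G$ be a locally finite connected graph with base vertex $e$, and let $f$ be a Floyd function with $\sum_{n=1}^\infty n f(n)<\infty$. Let $P=(p(v,w))_{v,w\in G}$ be the uniformly irreducible transition matrix of a random walk $(Z_n)_{n\ge0}$ on $G$ with uniform first moment, with spectral radius $\rho=\rho(P)<1$, and such that there is a constant $C>0$ with $p^{(n)}(v,w)\le C\rho^n$ for every $v,w\in G$ and $n\in\mathbb{N}$. Then the Dirichlet problem with respect to $P$ and the Floyd compactification $\bar G$ (associated with $f$) is solvable.
   Context: $G$ also denotes the vertex set; $v\sim w$ means $v,w$ are adjacent; $d$ is the graph distance; $e\in G$ is a fixed vertex and $|v|=d(e,v)$. Floyd function: a function $f:\{0,1,2,\dots\}\to(0,\infty)$ such that there is a constant $\lambda>0$ with $\lambda f(r)\le f(r+1)\le f(r)$ for every integer $r>0$, and $\sum_{r=0}^\infty f(r)<\infty$. Floyd boundary: an edge $[v,w]$ gets length $f(|[v,w]|)$, where $|[v,w]|=\min\{|v|,|w|\}$. A path $\alpha=(x_1,\dots,x_n)$ (consecutive vertices adjacent) has Floyd length $L_f(\alpha)=\sum_{i=1}^{n-1} f(|[x_i,x_{i+1}]|)$, and $d_f(v,w)=\inf_\alpha L_f(\alpha)$ over all paths $\alpha$ connecting $v$ and $w$. $\bar G$ is the metric completion of $(G,d_f)$ (a compact metric space, the Floyd compactification), and $\partial_f G=\bar G\setminus G$ is the Floyd boundary. Random walk: $p^{(n)}(v,w)$ are the entries of $P^n$. Uniformly irreducible: there are $c_0>0$ and $K>0$ such that for all $v\sim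 w$ there is an integer $\kappa<K$ with $p^{(\kappa)}(v,w)\ge c_0$. Spectral radius: $\rho(P)=\limsup_{n\to\infty}p^{(n)}(v,w)^{1/n}$ (independent of $v,w$ by irreducibility). Uniform first moment: $\overline m=\sum_{n=1}^\infty\phi(n)<\infty$, where $\phi(n)=\sup_{v\in G}\sigma_v([n,\infty))$ and $\sigma_v(n)=\sum_{w:d(v,w)=n}p(v,w)$ is the step length distribution at $v$. Dirichlet problem: it is solvable with respect to $P$ and $\bar G$ if every continuous function $\varphi:\partial_f G\to\mathbb{R}$ extends to a continuous function $h:\bar G\to\mathbb{R}$ that is harmonic on $G$, i.e. $h(v)=\sum_{w\in G}p(v,w)h(w)$ for all $v\in G$. *)

(* Defs.v *)
From mathcomp Require Import all_boot all_order all_algebra.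
From mathcomp Require Import all_classical all_reals all_analysis.

Set Implicit Arguments.
Unset Strict Implicit.
Unset Printing Implicit Defensive.

Import Order.TTheory GRing.Theory Num.Theory.
Import numFieldNormedType.Exports.

Local Open Scope classical_set_scope.
Local Open Scope ring_scope.

Section graph.
Variables (V : choiceType) (adj : rel V).

Definition locally_finite := forall v : V, finite_set [set w | adj v w].

(* The vertex sequence [v :: s] is a path from [v] to [w]. *)
Definition path_between (v w : V) (s : seq V) := path adj v s /\ last v s = w.

Definition connected_graph := forall v w : V, exists s, path_between v w s.

(* The minimum below exists as soon as [v] and [w] are connected by a path;
   the default value 0 is then irrelevant. *)
Definition gdist (v w : V) : nat :=
  xget 0%N [set n : nat | (exists2 s, path_between v w s & size s = n) /\
                          forall s, path_between v w s -> (n <= size s)%N].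

End graph.

Section floyd.
Variables (R : realType) (V : choiceType) (adj : rel V) (e : V) (f : nat -> R).

(* The monotonicity conditions are only imposed for [r > 0], so that [f 0] may
   be smaller than [f 1]. *)
Definition floyd_function :=
  [/\ forall r, 0 < f r,
      (exists2 lambda : R, 0 < lambda &
         forall r, (0 < r)%N -> lambda * f r <= f r.+1 /\ f r.+1 <= f r) &
      (\sum_(0 <= r <oo) (f r)%:E < +oo)%E].

Definition edge_length (v w : V) : R :=
  f (minn (gdist adj e v) (gdist adj e w)).

(* Floyd length of the path with vertex sequence [v :: s]. *)
Fixpoint floyd_length (v : V) (s : seq V) : R :=
  if s is w :: s' then edge_length v w + floyd_length w s' else 0.

Definition floyd_dist (v w : V) : R :=
  inf [set floyd_length v s | s in path_between adj v w].

End floyd.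

(* [X], together with the isometric embedding [iota], is a completion of [V]
   equipped with the metric [d]; this determines [X] up to a unique isometry
   compatible with [iota]. *)
Definition is_metric_completion (R : realType) (V : Type) (d : V -> V -> R)
    (X : metricType R) (iota : V -> X) :=
  [/\ forall v w, mdist (iota v) (iota w) = d v w,
      dense (range iota) &
      forall F : set_system X, ProperFilter F -> cauchy F ->
        exists x : X, F --> x].

Definition floyd_compactification (R : realType) (V : choiceType)
    (adj : rel V) (e : V) (f : nat -> R) (X : metricType R) (iota : V -> X) :=
  is_metric_completion (floyd_dist adj e f) iota.

Section random_walk.
Variables (R : realType) (V : choiceType) (adj : rel V) (p : V -> V -> R).

Definition transition_matrix :=
  (forall v w, 0 <= p v w) /\
  (forall v, \esum_(w in [set: V]) (p v w)%:E = 1%E).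

(* Entries of the matrix power [P ^ n]. *)
Fixpoint ptrans (n : nat) (v w : V) : \bar R :=
  if n is n'.+1 then (\esum_(u in [set: V]) ((p v u)%:E * ptrans n' u w))%E
  else ((v == w)%:R)%:E.

Definition uniformly_irreducible :=
  exists c0 : R, exists K : nat,
    [/\ 0 < c0, (0 < K)%N &
        forall v w, adj v w ->
          exists2 k : nat, (k < K)%N & (c0%:E <= ptrans k v w)%E].

Definition spectral_radius (v w : V) : \bar R :=
  limn_esup (fun n : nat => (ptrans n v w `^ (n%:R^-1))%E).

(* [step_dist v n] is sigma_v(n) and [step_tail v n] is sigma_v([n, oo)). *)
Definition step_dist (v : V) (n : nat) : \bar R :=
  \esum_(w in [set w | gdist adj v w = n]) (p v w)%:E.

Definition step_tail (v : V) (n : nat) : \bar R :=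
  (\sum_(n <= k <oo) step_dist v k)%E.

Definition sup_step_tail (n : nat) : \bar R :=
  ereal_sup [set step_tail v n | v in [set: V]].

Definition uniform_first_moment :=
  (\sum_(1 <= n <oo) sup_step_tail n < +oo)%E.

(* The series [\sum_w p v w * h w] converges absolutely to [h v]: since [\esum]
   only handles nonnegative families, the sum is written as the difference of
   those of the positive and negative parts. *)
Definition harmonic_on_graph (h : V -> R) :=
  forall v : V, let F := fun w : V => (p v w * h w)%:E in
    summable [set: V] F /\
    ((h v)%:E =
       \esum_(w in [set: V]) (F^\+ w) - \esum_(w in [set: V]) (F^\- w))%E.

(* [~` range iota] is the boundary of [V] in [X].  A function on the boundary
   is represented by a function on [X] whose values on [range iota] are not
   used. *)
Definition dirichlet_solvable (X : metricType R) (iota : V -> X) :=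
  forall phi : X -> R, {within ~` range iota, continuous phi} ->
    exists h : X -> R,
      [/\ continuous h,
          forall x, (~` range iota) x -> h x = phi x &
          harmonic_on_graph (h \o iota)].

End random_walk.

(* Main.v *)
Require Import Defs.
From mathcomp Require Import all_boot all_order all_algebra.
From mathcomp Require Import all_classical all_reals all_analysis.
From mathcomp Require Import ring lra.

Set Implicit Arguments.
Unset Strict Implicit.
Unset Printing Implicit Defensive.

Import Order.TTheory GRing.Theory Num.Theory.
Import numFieldNormedType.Exports.

Local Open Scope classical_set_scope.
Local Open Scope ring_scope.

(** Write [|v|] for the distance from [e] to [v], [d_f] for the Floyd distance
    and [P] for the transition operator, acting on bounded functions on the
    vertices.  The boundary function is first extended to a continuous function
    [F] on the Floyd compactification, which is a compact metric space
    ([compact_tietze]).  The solution is the uniform limit [h] of the iterates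
    [P ^ n F]: a uniform limit of iterates is harmonic ([harmonic_limit]), and
    if [h - F] tends to 0 as [|v|] tends to infinity, then [h] extends
    continuously by [F] on the boundary, because vertices are isolated points
    and only finitely many of them lie in each ball ([continuous_extension]).

    Let [drift v] be the mean of [d_f v] under [p v].  If [F] is [L]-Lipschitz
    on the vertices, then [|P F - F| <= L * drift], hence
    [|P ^ n.+1 F - P ^ n F| <= L * P ^ n drift] by positivity of [P].  So it
    suffices that the series of the [P ^ n drift] converges uniformly and that
    each of its terms vanishes at infinity.  A general continuous [F] is reduced
    to this case by uniform approximation with Lipschitz functions
    ([lipschitz_approximation]), as [P] is a contraction.

    Two facts control [P ^ n drift].
    - If [0 < j] and [|v| >= 2 j], then [drift v <= M * phi j + S * f j], where
      [M] bounds [d_f], [phi j] bounds the probability of a step of length at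
      least [j], and [S] bounds the sums of the [phi i], hence the mean length
      of a step: a step shorter than [j] is covered by edges of Floyd length at
      most [f j] ([drift_le]).
    - Uniform irreducibility bounds the degrees ([bounded_degree]), so balls
      grow at most exponentially, and the probability that the walk is in the
      ball of radius [r] at time [n] is at most [C * rho ^ n * D ^ r].  It
      decays exponentially when [r] is a small multiple of [n] ([escape_rate]).
    Taking [j] proportional to [n] gives the bound [drift_summable], because the
    series of [phi j] and of [f j] converge. *)

(** * The transition operator on bounded functions *)

Section transition_operator.
Context (R : realType) (V : choiceType).
Implicit Types (u : V -> R) (v w : V) (c : R) (n : nat).

Definition sup_bounded u := exists M, forall v, `|u v| <= M.

Lemma sup_boundedP u M N : (forall v, M <= u v <= N) -> sup_bounded u.
Proof.
move=> MuN; exists (`|M| + `|N|) => v; have /andP[Mu uN] := MuN v.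
have := ler_norm N; have := ler_norm (- M); rewrite normrN.
have := normr_ge0 M; have := normr_ge0 N; rewrite ler_norml; lra.
Qed.

Lemma sup_bounded_cst c : sup_bounded (fun=> c).
Proof. by exists `|c|. Qed.

Lemma sup_boundedD u1 u2 : sup_bounded u1 -> sup_bounded u2 ->
  sup_bounded (fun v => u1 v + u2 v).
Proof.
move=> [M1 u1M] [M2 u2M]; exists (M1 + M2) => v.
by rewrite (le_trans (ler_normD _ _))// lerD.
Qed.

Lemma sup_boundedN u : sup_bounded u -> sup_bounded (fun v => - u v).
Proof. by move=> [M uM]; exists M => v; rewrite normrN. Qed.

Lemma sup_boundedB u1 u2 : sup_bounded u1 -> sup_bounded u2 ->
  sup_bounded (fun v => u1 v - u2 v).
Proof. by move=> u1b u2b; apply: sup_boundedD => //; exact: sup_boundedN. Qed.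

Lemma sup_boundedZ c u : sup_bounded u -> sup_bounded (fun v => c * u v).
Proof.
by move=> [M uM]; exists (`|c| * M) => v; rewrite normrM ler_wpM2l.
Qed.

Lemma sup_bounded_norm u : sup_bounded u -> sup_bounded (fun v => `|u v|).
Proof. by move=> [M uM]; exists M => v; rewrite normr_id. Qed.

Lemma sup_bounded_sum (I : Type) (s : seq I) (u_ : I -> V -> R) :
  (forall i, sup_bounded (u_ i)) -> sup_bounded (fun v => \sum_(i <- s) u_ i v).
Proof.
move=> ub; elim: s => [|i s IHs].
  by under eq_fun do rewrite big_nil; exact: sup_bounded_cst.
by under eq_fun do rewrite big_cons; exact: sup_boundedD.
Qed.

Lemma sup_bounded_bool (P : V -> bool) : sup_bounded (fun v => (P v)%:R).
Proof. by apply: (@sup_boundedP _ 0 1) => v; case: (P v); rewrite lexx ler01. Qed.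

Lemma sup_bounded_pos u : sup_bounded u ->
  sup_bounded (fun v => Num.max (u v) 0).
Proof.
move=> [M uM]; apply: (@sup_boundedP _ 0 M) => v.
have := uM v; rewrite ler_norml => /andP[_ uvM].
rewrite le_max lexx orbT ge_max uvM.
exact: le_trans (normr_ge0 _) (uM v).
Qed.

Context (p : V -> V -> R).

(** [markov_op u v] is the mean of the bounded function [u] under [p v], that
    is the sum over [w] of [p v w * u w], taken as the difference of the sums of
    the positive and negative parts. *)
Definition markov_op u v : R :=
  let F := fun w : V => (p v w * u w)%:E in
  fine (\esum_(w in [set: V]) (F^\+ w))%E -
  fine (\esum_(w in [set: V]) (F^\- w))%E.

Hypothesis p_trans : transition_matrix p.

Let p_ge0 v w : 0 <= p v w. Proof. exact: p_trans.1. Qed.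

(* The mean of a nonnegative function, as an extended real. *)
Let nneg_mean u v : \bar R := (\esum_(w in [set: V]) (p v w * u w)%:E)%E.

Let nneg_mean_ge0 u v : (forall w, 0 <= u w) -> (0 <= nneg_mean u v)%E.
Proof.
by move=> u0; apply: esum_ge0 => w _; rewrite lee_fin mulr_ge0.
Qed.

Let nneg_meanZ c u v : 0 <= c -> (forall w, 0 <= u w) ->
  nneg_mean (fun w => c * u w) v = (c%:E * nneg_mean u v)%E.
Proof.
move=> c0 u0; rewrite /nneg_mean /esum -ereal_supZl//; last first.
  by apply/set0P; eexists; exists set0 => //; exact: fsets_set0.
congr ereal_sup; rewrite image_comp/=; apply: eq_imagel => A _ /=.
rewrite ge0_mule_fsumr; last by move=> w; rewrite lee_fin mulr_ge0.
by apply: eq_fsbigr => w _; rewrite -EFinM mulrCA.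
Qed.

Let nneg_meanD u1 u2 v : (forall w, 0 <= u1 w) -> (forall w, 0 <= u2 w) ->
  nneg_mean (fun w => u1 w + u2 w) v = (nneg_mean u1 v + nneg_mean u2 v)%E.
Proof.
move=> u10 u20; rewrite /nneg_mean -esumD.
- by apply: eq_esum => w _; rewrite mulrDr EFinD.
- by move=> w _; rewrite lee_fin mulr_ge0.
- by move=> w _; rewrite lee_fin mulr_ge0.
Qed.

Let nneg_mean_cst c v : 0 <= c -> nneg_mean (fun=> c) v = c%:E.
Proof.
move=> c0; rewrite -[RHS]mule1 -(p_trans.2 v) -[in LHS](mulr1 c).
rewrite (nneg_meanZ _ (u := fun=> 1))//; congr (_ * _)%E.
by apply: eq_esum => w _; rewrite mulr1.
Qed.

Let le_nneg_mean u1 u2 v : (forall w, u1 w <= u2 w) ->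
  (nneg_mean u1 v <= nneg_mean u2 v)%E.
Proof.
by move=> u12; apply: le_esum => w _; rewrite lee_fin ler_wpM2l.
Qed.

Let nneg_mean_fin u v : (forall w, 0 <= u w) -> sup_bounded u ->
  nneg_mean u v \is a fin_num.
Proof.
move=> u0 [M uM]; have M0 := le_trans (normr_ge0 _) (uM v).
rewrite ge0_fin_numE ?nneg_mean_ge0//; apply: le_lt_trans (ltry M).
rewrite -(nneg_mean_cst v M0); apply: le_nneg_mean => w.
exact: le_trans (ler_norm _) (uM w).
Qed.

Lemma summable_bounded u v : sup_bounded u ->
  summable [set: V] (fun w => (p v w * u w)%:E).
Proof.
move=> ub; rewrite /summable (_ : esum _ _ = nneg_mean (fun w => `|u w|) v).
  rewrite -ge0_fin_numE ?nneg_mean_ge0//.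
  by apply: nneg_mean_fin => //; exact: sup_bounded_norm.
by apply: eq_esum => w _; rewrite abse_EFin normrM ger0_norm.
Qed.

(** The operator does not depend on the way a bounded function is written as
    a difference of nonnegative ones; linearity rests on this. *)
Let markov_op_diff u1 u2 v : (forall w, 0 <= u1 w) -> (forall w, 0 <= u2 w) ->
    sup_bounded u1 -> sup_bounded u2 ->
  markov_op (fun w => u1 w - u2 w) v =
    fine (nneg_mean u1 v) - fine (nneg_mean u2 v).
Proof.
move=> u10 u20 u1b u2b; rewrite /markov_op.
pose F1 w := (p v w * u1 w)%:E; pose F2 w := (p v w * u2 w)%:E.
have -> : (fun w => (p v w * (u1 w - u2 w))%:E) = (F1 \- F2)%E.
  by apply/funext => w; rewrite mulrBr EFinB.
have Fs : summable [set: V] (F1 \- F2)%E.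
  by apply: summableB; exact: summable_bounded.
have Fp : (\esum_(w in [set: V]) ((F1 \- F2)^\+ w))%E \is a fin_num.
  have := summable_funepos Fs; rewrite summableE.
  by under eq_esum do rewrite gee0_abs//.
have Fn : (\esum_(w in [set: V]) ((F1 \- F2)^\- w))%E \is a fin_num.
  have := summable_funeneg Fs; rewrite summableE.
  by under eq_esum do rewrite gee0_abs//.
rewrite -fineB// esumB; do ?exact: summable_bounded.
- by rewrite fineB//; exact: nneg_mean_fin.
- by move=> w _; rewrite lee_fin mulr_ge0.
- by move=> w _; rewrite lee_fin mulr_ge0.
Qed.

Lemma markov_opE u v : (forall w, 0 <= u w) -> sup_bounded u ->
  (markov_op u v)%:E = (\esum_(w in [set: V]) (p v w * u w)%:E)%E.
Proof.
move=> u0 ub; rewrite -[RHS]fineK; last exact: nneg_mean_fin.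
congr EFin; have := markov_op_diff v u0 (fun=> lexx 0) ub (sup_bounded_cst 0).
rewrite nneg_mean_cst//= subr0 => <-; congr (markov_op _ v).
by apply/funext => w; rewrite subr0.
Qed.

Let pos u w := Num.max (u w) 0.

Let pos_ge0 u w : 0 <= pos u w. Proof. by rewrite le_max lexx orbT. Qed.

Let pos_diff u : u = (fun w => pos u w - pos (fun w => - u w) w).
Proof.
by apply/funext => w; rewrite /pos; case: (leP (u w) 0); case: (leP (- u w) 0);
  lra.
Qed.

Lemma markov_opD u1 u2 v : sup_bounded u1 -> sup_bounded u2 ->
  markov_op (fun w => u1 w + u2 w) v = markov_op u1 v + markov_op u2 v.
Proof.
move=> u1b u2b.
have [a1b a2b] := (sup_bounded_pos u1b, sup_bounded_pos u2b).
have b1b := sup_bounded_pos (sup_boundedN u1b).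
have b2b := sup_bounded_pos (sup_boundedN u2b).
rewrite [in RHS](pos_diff u1) [in RHS](pos_diff u2) !markov_op_diff//.
rewrite (_ : (fun w => _) = (fun w => (pos u1 w + pos u2 w) -
   (pos (fun w => - u1 w) w + pos (fun w => - u2 w) w))); last first.
  by apply/funext => w; rewrite [in LHS](pos_diff u1) [in LHS](pos_diff u2); lra.
rewrite markov_op_diff; do ?by [exact: sup_boundedD | move=> w; exact: addr_ge0].
rewrite !nneg_meanD// !fineD; do ?exact: nneg_mean_fin.
lra.
Qed.

Lemma markov_opN u v : sup_bounded u ->
  markov_op (fun w => - u w) v = - markov_op u v.
Proof.
move=> ub; have ab := sup_bounded_pos ub.
have bb := sup_bounded_pos (sup_boundedN ub).
rewrite [in RHS](pos_diff u) markov_op_diff// opprB -markov_op_diff//.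
by congr (markov_op _ v); apply/funext => w; rewrite [in LHS](pos_diff u) opprB.
Qed.

Lemma markov_opB u1 u2 v : sup_bounded u1 -> sup_bounded u2 ->
  markov_op (fun w => u1 w - u2 w) v = markov_op u1 v - markov_op u2 v.
Proof.
by move=> u1b u2b; rewrite markov_opD// ?markov_opN//; exact: sup_boundedN.
Qed.

Lemma markov_opZ c u v : 0 <= c -> sup_bounded u ->
  markov_op (fun w => c * u w) v = c * markov_op u v.
Proof.
move=> c0 ub; have ab := sup_bounded_pos ub.
have bb := sup_bounded_pos (sup_boundedN ub).
rewrite [in RHS](pos_diff u) markov_op_diff//.
rewrite (_ : (fun w => _) = (fun w => c * pos u w - c * pos (fun w => - u w) w));
  last by apply/funext => w; rewrite [in LHS](pos_diff u) mulrBr.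
rewrite markov_op_diff;
  do ?by [exact: sup_boundedZ | move=> w; exact: mulr_ge0].
rewrite !nneg_meanZ// !fineM; do ?by [|exact: nneg_mean_fin].
by rewrite /= mulrBr.
Qed.

Lemma markov_op_ge0 u v : (forall w, 0 <= u w) -> sup_bounded u ->
  0 <= markov_op u v.
Proof. by move=> u0 ub; rewrite -lee_fin markov_opE//; exact: nneg_mean_ge0. Qed.

Lemma le_markov_op u1 u2 v : sup_bounded u1 -> sup_bounded u2 ->
  (forall w, u1 w <= u2 w) -> markov_op u1 v <= markov_op u2 v.
Proof.
move=> u1b u2b u12; rewrite -subr_ge0 -markov_opB//.
by apply: markov_op_ge0; [move=> w; rewrite subr_ge0 | exact: sup_boundedB].
Qed.

Lemma markov_op_cst c v : markov_op (fun=> c) v = c.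
Proof.
have cE d : 0 <= d -> markov_op (fun=> d) v = d.
  move=> d0; apply: EFin_inj; rewrite markov_opE//; last exact: sup_bounded_cst.
  exact: nneg_mean_cst.
have [/cE//|/ltW] := leP 0 c; rewrite -oppr_ge0 => /cE.
by rewrite markov_opN; [move/oppr_inj | exact: sup_bounded_cst].
Qed.

Lemma markov_op_sum (I : Type) (s : seq I) (u_ : I -> V -> R) v :
  (forall i, sup_bounded (u_ i)) ->
  markov_op (fun w => \sum_(i <- s) u_ i w) v = \sum_(i <- s) markov_op (u_ i) v.
Proof.
move=> ub; elim: s => [|i s IHs].
  by under eq_fun do rewrite big_nil; rewrite big_nil markov_op_cst.
under eq_fun do rewrite big_cons; rewrite markov_opD//; last exact: sup_bounded_sum.
by rewrite big_cons IHs.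
Qed.

Lemma markov_op_between u M N v : (forall w, M <= u w <= N) ->
  M <= markov_op u v <= N.
Proof.
move=> MuN; have ub := sup_boundedP MuN.
apply/andP; split.
- rewrite -[leLHS](markov_op_cst M v); apply: le_markov_op => //.
    exact: sup_bounded_cst.
  by move=> w; have /andP[] := MuN w.
- rewrite -[leRHS](markov_op_cst N v); apply: le_markov_op => //.
    exact: sup_bounded_cst.
  by move=> w; have /andP[] := MuN w.
Qed.

Lemma markov_op_bounded u : sup_bounded u -> sup_bounded (markov_op u).
Proof.
move=> [M uM]; exists M => v; rewrite ler_norml.
by apply: markov_op_between => w; rewrite -ler_norml.
Qed.

Lemma harmonicP u : sup_bounded u -> (forall v, markov_op u v = u v) ->
  harmonic_on_graph p u.
Proof.
move=> ub Pu v /=; have us := summable_bounded v ub; split=> //.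
have := summable_funeneg us; rewrite summableE => n_fin.
have := summable_funepos us; rewrite summableE => p_fin.
rewrite -Pu /markov_op EFinB !fineK//.
- by rewrite -(@eq_esum _ _ _ _ _ (fun w _ => gee0_abs (funeneg_ge0 _ w))).
- by rewrite -(@eq_esum _ _ _ _ _ (fun w _ => gee0_abs (funepos_ge0 _ w))).
Qed.

(** The [n]-th power of the transition operator. *)
Definition markov_iter n := iter n markov_op.

Lemma markov_iter_bounded n u : sup_bounded u -> sup_bounded (markov_iter n u).
Proof. by move=> ub; elim: n => //= n; exact: markov_op_bounded. Qed.

Lemma le_markov_iter n u1 u2 v : sup_bounded u1 -> sup_bounded u2 ->
  (forall w, u1 w <= u2 w) -> markov_iter n u1 v <= markov_iter n u2 v.
Proof.
move=> u1b u2b u12; elim: n v => //= n IHn v.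
by apply: le_markov_op => //; exact: markov_iter_bounded.
Qed.

Lemma markov_iterD n u1 u2 v : sup_bounded u1 -> sup_bounded u2 ->
  markov_iter n (fun w => u1 w + u2 w) v = markov_iter n u1 v + markov_iter n u2 v.
Proof.
move=> u1b u2b; elim: n v => //= n IHn v.
rewrite -markov_opD; do ?exact: markov_iter_bounded.
by congr (markov_op _ v); apply/funext.
Qed.

Lemma markov_iterB n u1 u2 v : sup_bounded u1 -> sup_bounded u2 ->
  markov_iter n (fun w => u1 w - u2 w) v = markov_iter n u1 v - markov_iter n u2 v.
Proof.
move=> u1b u2b; elim: n v => //= n IHn v.
rewrite -markov_opB; do ?exact: markov_iter_bounded.
by congr (markov_op _ v); apply/funext.
Qed.

Lemma markov_iterZ n c u v : 0 <= c -> sup_bounded u ->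
  markov_iter n (fun w => c * u w) v = c * markov_iter n u v.
Proof.
move=> c0 ub; elim: n v => //= n IHn v.
rewrite -markov_opZ//; last exact: markov_iter_bounded.
by congr (markov_op _ v); apply/funext.
Qed.

Lemma markov_iter_cst n c v : markov_iter n (fun=> c) v = c.
Proof.
elim: n v => //= n IHn v; rewrite -[RHS](markov_op_cst c v).
by congr (markov_op _ v); apply/funext.
Qed.

Lemma markov_iter_sum n (I : Type) (s : seq I) (u_ : I -> V -> R) v :
  (forall i, sup_bounded (u_ i)) ->
  markov_iter n (fun w => \sum_(i <- s) u_ i w) v =
    \sum_(i <- s) markov_iter n (u_ i) v.
Proof.
move=> ub; elim: n v => //= n IHn v.
rewrite -markov_op_sum; last by move=> i; exact: markov_iter_bounded.
by congr (markov_op _ v); apply/funext.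
Qed.

Lemma markov_iter_between n u M N v : (forall w, M <= u w <= N) ->
  M <= markov_iter n u v <= N.
Proof. by move=> MuN; elim: n v => //= n IHn v; exact: markov_op_between. Qed.

Lemma markov_iter_dist n u1 u2 M v : sup_bounded u1 -> sup_bounded u2 ->
  (forall w, `|u1 w - u2 w| <= M) ->
  `|markov_iter n u1 v - markov_iter n u2 v| <= M.
Proof.
move=> u1b u2b u12; rewrite -markov_iterB// ler_norml.
by apply: markov_iter_between => w; rewrite -ler_norml.
Qed.

(** The entry [(v, w)] of the [n]-th power of the transition matrix is the value
    at [v] of the [n]-th iterate of the indicator function of [w]. *)
Lemma ptransE n v w :
  ptrans p n v w = (markov_iter n (fun x => (x == w)%:R) v)%:E.
Proof.
have wb : sup_bounded (fun x => (x == w)%:R) := sup_bounded_bool _.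
elim: n v => //= n IHn v; rewrite markov_opE.
- by apply: eq_esum => x _; rewrite IHn -EFinM.
- move=> x; apply: (proj1 (andP (@markov_iter_between n _ 0 1 x _))) => y.
  by case: eqP; rewrite ?lexx ?ler01.
- exact: markov_iter_bounded.
Qed.

End transition_operator.

(** * Nonnegative real sequences with bounded partial sums *)

Section small_tails.
Context (R : realType).
Implicit Types (a b : nat -> R) (c eps S : R).

(** The partial sums of [a] are bounded above. *)
Definition bounded_sums a := exists S, forall n, \sum_(0 <= i < n) a i <= S.

Lemma nneseries_bounded_sums a m : (forall n, 0 <= a n) ->
  (\sum_(m <= i <oo) (a i)%:E < +oo)%E -> bounded_sums (fun i => a (m + i)%N).
Proof.
move=> a0 afin; exists (fine (\sum_(m <= i <oo) (a i)%:E)%E) => n.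
have a0E i : (m <= i)%N -> true -> (0 <= (a i)%:E)%E by rewrite lee_fin.
rewrite -lee_fin fineK; last first.
  by rewrite ge0_fin_numE//; apply: nneseries_ge0 => i mi _; rewrite lee_fin.
rewrite -sumEFin.
rewrite (_ : (\sum_(0 <= i < n) _)%E = (\sum_(m <= i < (m + n)%N) (a i)%:E)%E).
  by apply: nneseries_lim_ge => i _ _; rewrite lee_fin.
have := big_addn 0 (m + n) m predT (fun i => (a i)%:E); rewrite add0n addKn => ->.
by apply: eq_bigr => i _; rewrite addnC.
Qed.

Lemma bounded_sumsD a b : bounded_sums a -> bounded_sums b ->
  bounded_sums (fun i => a i + b i).
Proof.
by move=> [S aS] [T bT]; exists (S + T) => n; rewrite big_split lerD.
Qed.

Lemma bounded_sumsZ c a : 0 <= c -> bounded_sums a ->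
  bounded_sums (fun i => c * a i).
Proof.
by move=> c0 [S aS]; exists (c * S) => n; rewrite -mulr_sumr ler_wpM2l.
Qed.

Lemma bounded_sums_half : bounded_sums (fun i => 2^-1 ^+ i).
Proof.
exists 2 => n; suff : \sum_(0 <= i < n) 2^-1 ^+ i = 2 - 2 * 2^-1 ^+ n :> R.
  have : 0 <= 2^-1 ^+ n :> R by rewrite exprn_ge0.
  lra.
elim: n => [|n IHn]; first by rewrite big_geq// expr0; lra.
by rewrite big_nat_recr//= IHn exprS; lra.
Qed.

(** Each value of [a] is repeated [q] times, so the sums are multiplied by [q]
    at most. *)
Lemma bounded_sums_divn a q : (forall n, 0 <= a n) -> (0 < q)%N ->
  bounded_sums a -> bounded_sums (fun i => a (i %/ q)%N).
Proof.
move=> a0 q0 [S aS]; exists (q%:R * S) => n.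
have block m : \sum_(0 <= i < (m * q)%N) a (i %/ q)%N = q%:R * \sum_(0 <= i < m) a i.
  elim: m => [|m IHm]; first by rewrite mul0n !big_geq// mulr0.
  rewrite mulSn addnC (big_cat_nat _ (n := (m * q)%N)) ?leq_addr//= IHm.
  rewrite big_nat_recr//= mulrDr; congr (_ + _).
  rewrite (eq_big_nat _ _ (F2 := fun=> a m)).
    by rewrite sumr_const_nat addKn mulr_natl.
  move=> i /andP[mi im]; congr a; apply/eqP.
  by rewrite eqn_leq leq_divRL// mi andbT -ltnS ltn_divLR// mulSn addnC.
apply: le_trans (_ : \sum_(0 <= i < (n * q)%N) a (i %/ q)%N <= _).
  rewrite (big_cat_nat (leq0n n) (leq_pmulr n q0))/=.
  by rewrite lerDl sumr_ge0.
by rewrite block ler_wpM2l.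
Qed.

Lemma bounded_sums_tail a : (forall n, 0 <= a n) -> bounded_sums a ->
  forall eps, 0 < eps -> exists N, forall m n, (N <= m)%N ->
    \sum_(m <= i < n) a i <= eps.
Proof.
move=> a0 [S aS] eps eps0; pose E := [set \sum_(0 <= i < n) a i | n in [set: nat]].
have Esup : has_sup E.
  by split; [exists (\sum_(0 <= i < 0) a i), 0%N | exists S => _ [n _ <-]].
have [_ [N _ <-] supN] := sup_adherent eps0 Esup.
exists N => m n Nm; have [nm|mn] := leqP n m; first by rewrite big_geq// ltW.
have /(ub_le_sup Esup.2) : E (\sum_(0 <= i < n) a i) by exists n.
rewrite (big_cat_nat _ (n := m)) ?(ltnW mn)//= (big_cat_nat _ (n := N))//=.
have : 0 <= \sum_(N <= i < m) a i by exact: sumr_ge0.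
lra.
Qed.

Lemma bounded_sums_small a : (forall n, 0 <= a n) -> bounded_sums a ->
  forall eps, 0 < eps -> exists N, forall n, (N <= n)%N -> a n <= eps.
Proof.
move=> a0 aS eps eps0; have [N aN] := bounded_sums_tail a0 aS eps0.
by exists N => n Nn; have := aN n n.+1 Nn; rewrite big_nat1.
Qed.

End small_tails.

(** * The graph distance *)

Section graph_distance.
Context (V : choiceType) (adj : rel V).
Hypothesis adj_conn : connected_graph adj.

Let gdistP (v w : V) :
  (exists2 s, path_between adj v w s & size s = gdist adj v w) /\
  forall s, path_between adj v w s -> (gdist adj v w <= size s)%N.
Proof.
rewrite /gdist; case: xgetP => [n -> //|noP].
have [s sP] := adj_conn v w.
pose Q n := `[< exists2 s, path_between adj v w s & size s = n >].
have exQ : exists n, Q n by exists (size s); apply/asboolP; exists s.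
case: (ex_minnP exQ) => n /asboolP Qn minQ; exfalso; apply: (noP n); split=> //.
by move=> t tP; apply: minQ; apply/asboolP; exists t.
Qed.

Lemma gdist_path v w : exists2 s, path_between adj v w s & size s = gdist adj v w.
Proof. exact: (gdistP v w).1. Qed.

Lemma gdist_le v w s : path_between adj v w s -> (gdist adj v w <= size s)%N.
Proof. exact: (gdistP v w).2. Qed.

Lemma gdist0_eq v w : gdist adj v w = 0%N -> v = w.
Proof. by have [s [_ <-] <-] := gdist_path v w; case: s. Qed.

Lemma gdist_adj v w : adj v w -> (gdist adj v w <= 1)%N.
Proof. by move=> vw; apply: (@gdist_le v w [:: w]); split=> //=; rewrite vw. Qed.

Lemma gdist_triangle u v w :
  (gdist adj u w <= gdist adj u v + gdist adj v w)%N.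
Proof.
have [s [us su] <-] := gdist_path u v; have [t [vt tv] <-] := gdist_path v w.
rewrite -size_cat; apply: gdist_le; split; first by rewrite cat_path us su.
by rewrite last_cat su.
Qed.

(** The last vertex but one on a geodesic from [e] to [v]. *)
Lemma gdist_pred e v n : gdist adj e v = n.+1 ->
  exists2 u, adj u v & gdist adj e u = n.
Proof.
move=> evn; have [s] := gdist_path e v; rewrite evn.
elim/last_ind: s => // s x _ [+ +]; rewrite rcons_path last_rcons size_rcons.
move=> /andP[es xs] xv [sn]; rewrite xv in xs; exists (last e s) => //.
have esn : (gdist adj e (last e s) <= n)%N by rewrite -sn; apply: gdist_le.
apply/eqP; rewrite eqn_leq esn -ltnS -evn -addn1.
by rewrite (leq_trans (gdist_triangle _ (last e s) _))// leq_add2l gdist_adj.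
Qed.

Hypothesis adj_sym : symmetric adj.

Lemma gdist_sym v w : gdist adj v w = gdist adj w v.
Proof.
suff le a b : (gdist adj a b <= gdist adj b a)%N by apply/eqP; rewrite eqn_leq !le.
have [s [bs sa] <-] := gdist_path b a.
have <- : size (rev (belast b s)) = size s by rewrite size_rev size_belast.
apply: gdist_le; split.
  have adjC : (fun x => adj^~ x) =2 adj by move=> x y; exact: adj_sym.
  by rewrite -sa rev_path (eq_path adjC).
case: s bs sa => [_ /= -> //|x s _ _]; rewrite /= rev_cons last_rcons.
by [].
Qed.

(** Balls grow at most exponentially when the degrees are bounded. *)
Lemma ball_card_le e D : (0 < D)%N ->
    (forall u, exists s : seq V,
       (forall w, adj u w -> w \in s) /\ (size s < D)%N) ->
  forall r, exists2 s : seq V, forall v, (gdist adj e v <= r)%N -> v \in s &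
    (size s <= D ^ r)%N.
Proof.
move=> D0 /choice[nb nbP]; elim=> [|r [s sP sD]].
  exists [:: e] => // v; rewrite leqn0 => /eqP/gdist0_eq <-.
  by rewrite mem_head.
exists (flatten [seq u :: nb u | u <- s]) => [v|].
  rewrite leq_eqVlt ltnS => /orP[/eqP /gdist_pred[u uv uE]|/sP vs].
    apply/flatten_mapP; exists u; first by apply: sP; rewrite uE.
    by rewrite inE (nbP u).1 ?orbT.
  by apply/flatten_mapP; exists v => //; rewrite mem_head.
rewrite expnS mulnC (leq_trans _ (leq_mul sD (leqnn D)))//.
elim: (s) => //= u t IHt; rewrite mulSn size_cat/= -addSn.
exact: leq_add (nbP u).2 IHt.
Qed.

End graph_distance.

(** * The Floyd distance *)

Section floyd_metric.
Context (R : realType) (V : choiceType) (adj : rel V) (e : V) (f : nat -> R).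
Hypothesis adj_conn : connected_graph adj.
Hypothesis adj_sym : symmetric adj.
Hypothesis f_floyd : floyd_function f.
Implicit Types (u v w : V) (s : seq V).

Let df := floyd_dist adj e f.
Let norm v := gdist adj e v.

Lemma floyd_fun_gt0 r : 0 < f r. Proof. by have [] := f_floyd. Qed.

Lemma floyd_fun_le i j : (0 < i <= j)%N -> f j <= f i.
Proof.
have [_ [lambda _ fS] _] := f_floyd.
move=> /andP[i0]; elim: j => [|j IHj]; first by rewrite leqNgt i0.
rewrite leq_eqVlt ltnS => /orP[/eqP <-//|ij].
by rewrite (le_trans (fS j _).2) ?IHj// (leq_trans i0).
Qed.

Lemma floyd_fun_bounded_sums : bounded_sums f.
Proof.
have [_ _ fS] := f_floyd.
exact: (nneseries_bounded_sums (m := 0) (fun n => ltW (floyd_fun_gt0 n))).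
Qed.

Lemma floyd_length_ge0 v s : 0 <= floyd_length adj e f v s.
Proof.
by elim: s v => //= w s IHs v; rewrite addr_ge0// ltW// floyd_fun_gt0.
Qed.

Lemma floyd_dist_le v w s : path_between adj v w s ->
  df v w <= floyd_length adj e f v s.
Proof.
move=> vws; apply: ge_inf; last by exists s.
by exists 0 => _ [t _ <-]; exact: floyd_length_ge0.
Qed.

Lemma floyd_dist_ge c v w :
  (forall s, path_between adj v w s -> c <= floyd_length adj e f v s) ->
  c <= df v w.
Proof.
move=> cs; apply: lb_le_inf => [|_ [s vws <-]]; last exact: cs.
by have [s vws] := adj_conn v w; exists (floyd_length adj e f v s), s.
Qed.

Lemma floyd_dist_adj v w : adj v w -> df v w <= f (minn (norm v) (norm w)).
Proof.
move=> vw; apply: le_trans (floyd_dist_le (s := [:: w]) _) _.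
  by split=> //=; rewrite vw.
by rewrite /= addr0.
Qed.

Lemma norm_adj v w : adj v w -> (norm v <= (norm w).+1)%N.
Proof.
move=> vw; rewrite -addn1 (leq_trans (gdist_triangle _ _ w _))// leq_add2l.
by apply: gdist_adj => //; rewrite adj_sym.
Qed.

(** All vertices of a geodesic from [v] to [w] are at distance at least [j] from
    [e], so its edges have Floyd length at most [f j].  This needs [0 < j], as
    [f 0] may be smaller than [f 1]. *)
Lemma floyd_dist_far j v w : (0 < j)%N -> (j + gdist adj v w <= norm v)%N ->
  df v w <= f j *+ gdist adj v w.
Proof.
move=> j0; have [s vws <-] := gdist_path adj_conn v w => jv.
apply: le_trans (floyd_dist_le vws) _.
elim: s v {vws}(vws.1) jv => //= x s IHs v /andP[vx xs] jv.
have jx : (j + size s <= norm x)%N.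
  by rewrite -ltnS -addnS (leq_trans jv)// norm_adj.
rewrite mulrS lerD ?IHs// floyd_fun_le// j0 leq_min.
by rewrite (leq_trans (leq_addr _ _) jv) (leq_trans (leq_addr _ _) jx).
Qed.

(** A path leaving [v] starts with an edge of length [f r] for some [r] at most
    the distance from [e] to [v]. *)
Lemma floyd_dist_isolated v :
  exists2 delta, 0 < delta & forall w, v != w -> delta <= df v w.
Proof.
have [delta d0 df_ge] : exists2 delta, 0 < delta &
    forall r, (r <= norm v)%N -> delta <= f r.
  elim: (norm v) => [|n [delta d0 IHn]].
    by exists (f 0) => [|r]; rewrite ?floyd_fun_gt0// leqn0 => /eqP ->.
  exists (Num.min delta (f n.+1)) => [|r].
    by rewrite lt_min d0 floyd_fun_gt0.
  rewrite leq_eqVlt ltnS ge_min => /orP[/eqP ->|/IHn ->//].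
  by rewrite lexx orbT.
exists delta => // w vw; apply: floyd_dist_ge => -[|x s] /= [_ vs].
  by move: vw; rewrite -vs eqxx.
rewrite -[delta]addr0 lerD ?floyd_length_ge0//.
by apply: df_ge; rewrite geq_minl.
Qed.

Context (X : metricType R) (iota : V -> X).
Hypothesis iota_isom : forall v w, mdist (iota v) (iota w) = df v w.

Lemma floyd_dist_triangle u v w : df u w <= df u v + df v w.
Proof. by rewrite -!iota_isom; exact: metric_triangle. Qed.

Lemma floyd_distC v w : df v w = df w v.
Proof. by rewrite -!iota_isom metric_sym. Qed.

(** Descending along a geodesic to the sphere of radius [N]. *)
Lemma floyd_dist_sphere N v : (N <= norm v)%N ->
  exists2 u, norm u = N & df u v <= \sum_(N <= i < norm v) f i.
Proof.
move: {-1}(norm v) (erefl (norm v)) => n; elim: n v => [|n IHn] v vn.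
  rewrite leqn0 => /eqP ->; exists v => //.
  by rewrite big_geq// -iota_isom mdistxx.
rewrite leq_eqVlt ltnS => /orP[/eqP ->|Nn].
  by exists v => //; rewrite big_geq// -iota_isom mdistxx.
have [x xv xn] := gdist_pred adj_conn vn.
have [u uN ux] := IHn x xn Nn; exists u => //.
rewrite big_nat_recr//= (le_trans (floyd_dist_triangle u x v))// lerD//.
rewrite (le_trans (floyd_dist_adj xv))//.
by rewrite [norm x]xn vn (minn_idPl (leqnSn n)).
Qed.

Lemma floyd_dist_bounded : exists2 M, 0 <= M & forall v w, df v w <= M.
Proof.
have [S fS] := floyd_fun_bounded_sums; exists (S + S).
  by have := fS 0%N; rewrite big_geq// => S0; rewrite addr_ge0.
have le_S v : df e v <= S.
  have [u /(gdist0_eq adj_conn) <- uv] := floyd_dist_sphere (leq0n (norm v)).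
  exact: le_trans uv (fS _).
move=> v w; rewrite (le_trans (floyd_dist_triangle v e w))// lerD//.
by rewrite floyd_distC.
Qed.

(** The vertices of a large ball form a finite net for [df]. *)
Lemma floyd_dist_net eps : 0 < eps ->
  exists N, forall v, exists2 u, (norm u <= N)%N & df u v <= eps.
Proof.
move=> eps0; have f0 n := ltW (floyd_fun_gt0 n).
have [N fN] := bounded_sums_tail f0 floyd_fun_bounded_sums eps0.
exists N => v; have [vN|/ltnW Nv] := leqP (norm v) N.
  by exists v => //; rewrite -iota_isom mdistxx ltW.
have [u uN uv] := floyd_dist_sphere Nv; exists u; first by rewrite uN.
exact: le_trans uv (fN _ _ (leqnn N)).
Qed.

End floyd_metric.

(** * Continuous functions on compact metric spaces *)

Section metric_space.
Context (R : realType) (X : metricType R).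
Implicit Types (x y : X) (F : X -> R) (eps : R).

Lemma nbhs_distP x (P : set X) :
  nbhs x P <-> exists2 delta, 0 < delta & forall y, mdist x y < delta -> P y.
Proof.
split=> [/nbhs_ballP[delta d0 dP]|[delta d0 dP]].
  by exists delta => // y xy; apply: dP; rewrite ballEmdist.
by apply/nbhs_ballP; exists delta => // y; rewrite ballEmdist => /dP.
Qed.

(** An ultrafilter on a totally bounded space contains a ball of every radius,
    so it is a Cauchy filter. *)
Lemma compact_of_nets :
    (forall F : set_system X, ProperFilter F -> cauchy F ->
       exists x : X, F --> x) ->
    (forall eps, 0 < eps ->
       exists s : seq X, forall x, exists2 y, y \in s & mdist y x < eps) ->
  compact [set: X].
Proof.
move=> X_complete nets; rewrite compact_ultra => F UF _.
suff /X_complete[x Fx] : cauchy F by exists x.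
apply: cauchy_exP => eps /nets[s sP].
have : F [set x | exists2 y, y \in s & mdist y x < eps].
  by apply: (filterS (P := setT)) => [x _|]; [exact: sP | exact: filterT].
elim: s {sP} => [|y s IHs] Fs.
  suff /(@filter_not_empty _ F) : F set0 by [].
  by apply: filterS Fs => x [].
have [Fy|Fy] := in_ultra_setVsetC (ball y eps) UF; first by exists y.
apply: IHs; apply: filterS (filterI Fs Fy) => x [[z + zx] yx].
rewrite inE => /orP[/eqP zy|zs]; last by exists z.
by exfalso; apply: yx; rewrite ballEmdist -zy.
Qed.

Hypothesis X_compact : compact [set: X].

Lemma compact_unif_continuous F eps : continuous F -> 0 < eps ->
  exists2 delta, 0 < delta & forall x y, mdist x y < delta -> `|F x - F y| < eps.
Proof.
move=> F_cont eps0.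
have /compact_near_coveringP X_cov := X_compact.
pose P (delta : R) x := forall y, mdist x y < delta -> `|F x - F y| < eps.
have := X_cov R 0^'+ P _; case.
  move=> x _; have eps2 : 0 < eps / 2 by rewrite divr_gt0.
  have /cvgrPdist_lt/(_ _ eps2)/nbhs_distP[r r0 rF] := F_cont x.
  have r2 : 0 < r / 2 by rewrite divr_gt0.
  exists (ball x (r / 2), [set delta | delta < r / 2]).
    by split; [exact: nbhsx_ballx | exact: nbhs_right_lt].
  move=> [x' delta] /= [xx' dr] y x'y; rewrite ballEmdist/= in xx'.
  have Fx' : `|F x - F x'| < eps / 2 by apply: rF; lra.
  have Fy : `|F x - F y| < eps / 2.
    by apply: rF; have := metric_triangle x x' y; lra.
  have := ler_distD (F x) (F x') (F y); rewrite (distrC (F x') (F x)); lra.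
move=> delta /= d0 dP.
exists (delta / 2); first by rewrite divr_gt0.
move=> x y xy;  apply: (dP (delta / 2)) => //=. 
- by rewrite /ball/= sub0r normrN gtr0_norm ?divr_gt0//; lra.
- by rewrite divr_gt0.
Qed.

Lemma compact_continuous_bounded F : continuous F ->
  exists2 M, 0 < M & forall x, `|F x| <= M.
Proof.
move=> F_cont.
have /compact_bounded : compact (F @` [set: X]).
  by apply: continuous_compact => //; exact: continuous_subspaceT.
have M1 (M : R) : M < `|M| + 1 by rewrite ltr_pwDr// ler_norm.
move=> [M [_ MF]]; exists (`|M| + 1) => [|x]; first by rewrite ltr_pwDr.
by apply: (MF _ (M1 M)); exists x.
Qed.

(** A continuous function on a compact metric space is Lipschitz up to an
    arbitrarily small error. *)
Lemma compact_almost_lipschitz F eps : continuous F -> 0 < eps ->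
  exists2 L, 0 <= L & forall x y, F x - F y <= eps + L * mdist x y.
Proof.
move=> F_cont eps0; have [M M0 FM] := compact_continuous_bounded F_cont.
have [delta d0 dF] := compact_unif_continuous F_cont eps0.
have L0 : 0 <= 2 * M / delta by rewrite divr_ge0 ?mulr_ge0// ltW.
exists (2 * M / delta) => // x y; have [xy|xy] := ltP (mdist x y) delta.
  have /ltW := dF _ _ xy; have := ler_norm (F x - F y).
  have := mulr_ge0 L0 (mdist_ge0 x y); lra.
have : 2 * M <= 2 * M / delta * mdist x y.
  by rewrite mulrAC ler_pdivlMr// ler_wpM2l// ltW// mulr_gt0.
have := FM x; have := FM y; rewrite !ler_norml; lra.
Qed.

(** The approximation is the infimal convolution of [F] with [L] times the
    distance. *)
Lemma lipschitz_approximation F eps : continuous F -> 0 < eps ->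
  exists2 L, 0 <= L & exists G : X -> R,
    (forall x y, `|G x - G y| <= L * mdist x y) /\
    (forall x, `|F x - G x| <= eps).
Proof.
move=> F_cont eps0.
have [L L0 FL] := compact_almost_lipschitz F_cont eps0; exists L => //.
pose E x := [set F y + L * mdist x y | y in [set: X]].
have Elb x : lbound (E x) (F x - eps).
  by move=> _ [y _ <-]; have := FL x y; lra.
have hElb x : has_lbound (E x) by exists (F x - eps).
have E0 x : E x !=set0 by exists (F x + L * mdist x x), x.
have EL x y : inf (E x) <= inf (E y) + L * mdist x y.
  rewrite -lerBlDr; apply: lb_le_inf => // _ [z _ <-].
  rewrite lerBlDr -addrA -mulrDr.
  apply: le_trans (ge_inf (hElb x) (x := F z + L * mdist x z) _) _.
    by exists z.
  by rewrite lerD2l ler_wpM2l// addrC metric_triangle.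
exists (fun x => inf (E x)); split=> [x y|x].
  have := EL x y; have := EL y x; rewrite (metric_sym y x) ler_norml; lra.
have := lb_le_inf (E0 x) (@Elb x).
have /(ge_inf (hElb x)) : E x (F x) by exists x; rewrite // mdistxx mulr0 addr0.
rewrite ler_norml; lra.
Qed.

Lemma compact_tietze (A : set X) (phi : X -> R) :
    closed A -> {within A, continuous phi} ->
  exists F : X -> R, continuous F /\ forall x, A x -> F x = phi x.
Proof.
move=> Acl phi_cont.
have /compact_bounded : compact (phi @` A).
  by apply: continuous_compact => //; exact: subclosed_compact Acl X_compact _.
move=> [M [_ MF]]; have M0 : 0 < `|M| + 1 by rewrite ltr_pwDr.
have M1 : M < `|M| + 1 by rewrite ltr_pwDr// ler_norm.
have phiM x : A x -> `|phi x| <= `|M| + 1 by move=> Ax; apply: (MF _ M1); exists x.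
have [F [FE F_cont _]] :=
  continuous_bounded_extension pseudometric_normal Acl M0 phi_cont phiM.
by exists F; split=> // x Ax; rewrite FE// inE.
Qed.

End metric_space.

(** * The completion of a discrete metric space *)

Section discrete_completion.
Context (R : realType) (V : choiceType) (d : V -> V -> R).
Context (X : metricType R) (iota : V -> X).
Hypothesis iota_compl : is_metric_completion d iota.
Hypothesis d_isolated : forall v,
  exists2 delta, 0 < delta & forall w, v != w -> delta <= d v w.

Let iotaE v w : mdist (iota v) (iota w) = d v w.
Proof. by have [] := iota_compl. Qed.

Lemma completion_dense x eps : 0 < eps -> exists v, mdist x (iota v) < eps.
Proof.
move=> eps0; have [_ iota_dense _] := iota_compl.
have [|y [/interior_subset + [v _ vy]]] :=
    iota_dense (ball x eps)° _ (open_interior _).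
  by exists x; exact: nbhsx_ballx.
by rewrite ballEmdist /= -vy => xv; exists v.
Qed.

Lemma completion_inj : injective iota.
Proof.
move=> v w vw; apply/eqP; apply/negPn/negP => /eqP vw'.
have [delta d0 /(_ w)] := d_isolated v.
by rewrite -iotaE vw mdistxx => /(_ (introN eqP vw')); rewrite leNgt d0.
Qed.

(** Points isolated in a dense subset are isolated in the whole space. *)
Lemma completion_isolated v :
  exists2 delta, 0 < delta & forall x, mdist (iota v) x < delta -> x = iota v.
Proof.
have [delta d0 dv] := d_isolated v; exists delta => // x vx.
have [//|xv] := eqVneq x (iota v).
have vx0 : 0 < mdist (iota v) x by rewrite mdist_gt0 eq_sym.
have [|w xw] := @completion_dense x
    (Num.min (mdist (iota v) x) (delta - mdist (iota v) x)).
  by rewrite lt_min vx0 subr_gt0.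
move: xw; rewrite lt_min => /andP[xw1 xw2].
have [vw|vw] := eqVneq v w.
  by move: xw1; rewrite -vw metric_sym ltxx.
have := dv w vw; rewrite -iotaE leNgt => /negP[].
by rewrite (le_lt_trans (metric_triangle _ x _))// -ltrBrDl.
Qed.

Lemma boundary_closed : closed (~` range iota).
Proof.
apply: open_closedC; rewrite openE => _ [v _ <-].
have [delta d0 dv] := completion_isolated v.
by apply/nbhs_distP; exists delta => // y /dv ->; exists v.
Qed.

(* Balls for [norm] are finite, so the boundary lies at infinity. *)
Context (norm : V -> nat).
Hypothesis norm_ball : forall r,
  exists s : seq V, forall v, (norm v <= r)%N -> v \in s.

Lemma boundary_far x r : (~` range iota) x ->
  exists2 delta, 0 < delta &
    forall v, mdist x (iota v) < delta -> (r < norm v)%N.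
Proof.
move=> xN; have [s sr] := norm_ball r.
suff [delta d0 ds] : exists2 delta, 0 < delta &
    forall v, v \in s -> delta <= mdist x (iota v).
  exists delta => // v xv; rewrite ltnNge; apply/negP => /sr/ds.
  by rewrite leNgt xv.
elim: s {sr} => [|u s [delta d0 ds]]; first by exists 1.
exists (Num.min delta (mdist x (iota u))) => [|v].
  rewrite lt_min d0 mdist_gt0; apply/eqP => xu; apply: xN.
  by exists u.
rewrite inE ge_min => /orP[/eqP ->|/ds ->//].
by rewrite lexx orbT.
Qed.

(** A function on the vertices that is asymptotic to a continuous function on
    the completion extends continuously by the latter. *)
Lemma continuous_extension (F : X -> R) (h : V -> R) : continuous F ->
    (forall eps, 0 < eps -> exists r, forall v, (r < norm v)%N ->
       `|h v - F (iota v)| <= eps) ->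
  exists H : X -> R, [/\ continuous H, forall v, H (iota v) = h v &
    forall x, (~` range iota) x -> H x = F x].
Proof.
move=> F_cont hF.
pose H x := if pselect (exists v, x = iota v) is left xv
  then h (projT1 (cid xv)) else F x.
have Hv v : H (iota v) = h v.
  rewrite /H; case: pselect => [xv|[]]; last by exists v.
  by case: cid => w /= /completion_inj ->.
have HF x : (~` range iota) x -> H x = F x.
  move=> xN; rewrite /H; case: pselect => // -[v xv].
  by exfalso; apply: xN; exists v.
exists H; split=> // x; apply/cvgrPdist_lt => eps eps0; apply/nbhs_distP.
have [[v _ <-]|xN] := pselect (range iota x).
  have [delta d0 dv] := completion_isolated v.
  by exists delta => // y /dv ->; rewrite subrr normr0.
have eps2 : 0 < eps / 2 by rewrite divr_gt0.
have /cvgrPdist_lt/(_ _ eps2)/nbhs_distP[d1 d10 d1F] := F_cont x.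
have [r rF] := hF _ eps2; have [d2 d20 d2r] := boundary_far r xN.
exists (Num.min d1 d2) => [|y]; first by rewrite lt_min d10.
rewrite lt_min HF// => /andP[/d1F xy yd2].
have [[v _ vy]|yN] := pselect (range iota y); last by rewrite HF//; lra.
rewrite -vy in xy yd2 *; rewrite Hv.
have := rF v (d2r v yd2); rewrite distrC.
by have := ler_distD (F (iota v)) (F x) (h v); lra.
Qed.

End discrete_completion.

(** * Uniform limits of the iterates *)

Section uniform_convergence.
Context (R : realType) (V : choiceType) (p : V -> V -> R).
Hypothesis p_trans : transition_matrix p.

(** The limit [h] of the iterates of [u] is harmonic, since [markov_op] is a
    contraction for the uniform norm. *)
Lemma harmonic_limit (u : V -> R) : sup_bounded u ->
    (forall eps : R, 0 < eps -> exists N, forall m n v, (N <= m)%N -> (N <= n)%N ->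
       `|markov_iter p m u v - markov_iter p n u v| <= eps) ->
  exists2 h : V -> R, harmonic_on_graph p h &
    forall eps, 0 < eps -> exists N, forall n v, (N <= n)%N ->
      `|markov_iter p n u v - h v| <= eps.
Proof.
move=> ub uC.
have u_cvg v : cvgn (fun n => markov_iter p n u v : R^o).
  apply/cauchy_cvgP/cauchy_exP => eps eps0.
  have eps2 : 0 < eps / 2 by rewrite divr_gt0.
  have [N NC] := uC _ eps2; exists (markov_iter p N u v); exists N => // n /= Nn.
  apply: le_lt_trans (NC N n v (leqnn N) Nn) _.
  by rewrite ltr_pdivrMr// ltr_pMr// ltr1n.
pose h v := limn (fun n => markov_iter p n u v : R^o).
have hP (eps : R) : 0 < eps -> exists N, forall n v, (N <= n)%N ->
    `|markov_iter p n u v - h v| <= eps.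
  move=> eps0; have eps2 : 0 < eps / 2 by rewrite divr_gt0.
  have [N NC] := uC _ eps2; exists N => n v Nn.
  have /cvgrPdist_le/(_ _ eps2)[N' _ N'P] := u_cvg v.
  have := N'P (maxn N N') (leq_maxr _ _); have := NC n (maxn N N') v Nn (leq_maxl _ _).
  rewrite -/(h v) !ler_norml /=; lra.
have hb : sup_bounded h.
  have [N NP] := hP 1 ltr01.
  have [M MP] := markov_iter_bounded p_trans N ub.
  exists (1 + M) => v; have := NP N v (leqnn N); have := MP v.
  rewrite !ler_norml; lra.
exists h => //; apply: harmonicP => // v; apply/eqP; rewrite -subr_eq0 -normr_le0.
apply/ler_addgt0Pl => eps eps0; rewrite addr0.
have eps2 : 0 < eps / 2 by rewrite divr_gt0.
have [N NP] := hP _ eps2.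
have := NP N.+1 v (leqnSn N).
have := markov_iter_dist p_trans 1 v (markov_iter_bounded p_trans N ub) hb
  (NP N ^~ (leqnn N)).
rewrite /= !ler_norml; lra.
Qed.

End uniform_convergence.

(** * Functions vanishing at infinity *)

Section vanishing.
Context (R : realType) (V : choiceType) (norm : V -> nat).

(** [u] tends to [0] as [norm] tends to infinity. *)
Definition vanishing (u : V -> R) := forall eps, 0 < eps ->
  exists r, forall v, (r < norm v)%N -> `|u v| <= eps.

Lemma vanishing_le (a : V -> R) (u : V -> R) :
  (forall v, `|u v| <= `|a v|) -> vanishing a -> vanishing u.
Proof.
move=> ua av eps /av[r ar]; exists r => v /ar; exact: le_trans.
Qed.

Lemma vanishingD u1 u2 : vanishing u1 -> vanishing u2 ->
  vanishing (fun v => u1 v + u2 v).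
Proof.
move=> u1v u2v eps eps0; have eps2 : 0 < eps / 2 by rewrite divr_gt0.
have [r1 r1P] := u1v _ eps2; have [r2 r2P] := u2v _ eps2.
exists (maxn r1 r2) => v; rewrite gtn_max => /andP[/r1P u1e /r2P u2e].
by apply: le_trans (ler_normD _ _) _; rewrite [eps]splitr lerD.
Qed.

Lemma vanishing_norm u : vanishing u -> vanishing (fun v => `|u v|).
Proof. by apply: vanishing_le => v; rewrite normr_id. Qed.

Lemma vanishingZ c u : vanishing u -> vanishing (fun v => c * u v).
Proof.
move=> uv eps eps0; have c0 : 0 < `|c| + 1 by rewrite ltr_pwDr.
have [r rP] := uv _ (divr_gt0 eps0 c0); exists r => v /rP.
rewrite ler_pdivlMr// normrM mulrC => /(le_trans _); apply.
by rewrite ler_wpM2r// lerDl.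
Qed.

End vanishing.

(** * Bounded degree *)

Section walk_on_graph.
Context (R : realType) (V : choiceType) (adj : rel V) (p : V -> V -> R).
Hypothesis adj_lf : locally_finite adj.
Hypothesis p_trans : transition_matrix p.

(** The probabilities of the positions at the times [k < K] add up to [K].
    Every neighbour of [u] accounts for at least [c0] of this total, so [u] has
    at most [K / c0] neighbours. *)
Lemma bounded_degree : uniformly_irreducible adj p ->
  exists2 D, (0 < D)%N & forall u, exists s : seq V,
    (forall w, adj u w -> w \in s) /\ (size s < D)%N.
Proof.
move=> [c0 [K [c00 K0 irr]]].
have Kc0 : 0 <= K%:R / c0 by rewrite divr_ge0// ltW.
have KD := archi_boundP Kc0; set D := Num.bound _ in KD.
exists D => [|u]; first by rewrite -(ltr_nat R); exact: le_lt_trans KD.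
have [s s_uniq sP] : exists2 s : seq V, uniq s & forall w, (w \in s) = adj u w.
  have /finite_seqP[t tE] := adj_lf u; exists (undup t) => [|w].
    exact: undup_uniq.
  rewrite mem_undup; have /seteqP[ut tu] := tE.
  by apply/idP/idP => [/tu|/ut].
exists s; split=> [w|]; first by rewrite -sP.
rewrite -(ltr_nat R); apply: le_lt_trans KD; rewrite ler_pdivlMr//.
have indb w : sup_bounded (fun x : V => (x == w)%:R : R) :=
  sup_bounded_bool R (fun x => x == w).
have ind_ge0 k w : 0 <= markov_iter p k (fun x => (x == w)%:R) u.
  suff /andP[] : 0 <= markov_iter p k (fun x => (x == w)%:R) u <= 1 by [].
  by apply: markov_iter_between => // x; case: eqP; rewrite ?lexx ?ler01.
apply: (@le_trans _ _ (\sum_(w <- s) \sum_(k < K)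
    markov_iter p k (fun x => (x == w)%:R) u)).
  have -> : (size s)%:R * c0 = \sum_(w <- s) c0.
    by rewrite big_const_seq count_predT iter_addr_0 mulr_natl.
  rewrite big_seq [leRHS]big_seq.
  apply: ler_sum => w; rewrite sP => /irr[k kK].
  rewrite ptransE// lee_fin => /le_trans; apply.
  by rewrite (bigD1 (Ordinal kK))//= lerDl sumr_ge0.
rewrite exchange_big/=; apply: (@le_trans _ _ (\sum_(k < K) 1)).
  apply: ler_sum => k _; rewrite -markov_iter_sum//.
  suff /andP[] : 0 <= markov_iter p k (fun x => \sum_(w <- s) (x == w)%:R) u <= 1.
    by [].
  apply: markov_iter_between => // x.
  suff -> : \sum_(w <- s) (x == w)%:R = (count_mem x s)%:R :> R.
    by rewrite count_uniq_mem//; case: (x \in s); rewrite lexx ler01.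
  elim: (s) => [|w t IHt]; first by rewrite big_nil.
  by rewrite big_cons IHt/= natrD eq_sym.
by rewrite sumr_const card_ord.
Qed.

End walk_on_graph.

(** * Step lengths *)

Section step_length.
Context (R : realType) (V : choiceType) (adj : rel V) (p : V -> V -> R).
Hypothesis p_trans : transition_matrix p.

Let step_bounded v n : sup_bounded (fun w => (n <= gdist adj v w)%N%:R : R) :=
  sup_bounded_bool R (fun w => n <= gdist adj v w)%N.

Lemma step_tailE v n : step_tail adj p v n =
  (markov_op p (fun w => (n <= gdist adj v w)%N%:R) v)%:E.
Proof.
have p0 w : (0 <= (p v w)%:E)%E by rewrite lee_fin; exact: p_trans.1.
rewrite markov_opE//.
rewrite /step_tail -nneseries_addn; last by move=> i; exact: esum_ge0.
rewrite -(@nneseries_sum_bigcup _ _ (fun i => [set w | gdist adj v w = (i + n)%N])).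
- rewrite esum_mkcond; apply: eq_esum => w _.
  case: ifPn => [/set_mem[i _ /= ->]|/negP wn]; first by rewrite leq_addl mulr1.
  rewrite (_ : (n <= _)%N = false) ?mulr0//; apply/negbTE/negP => nw.
  by apply: wn; apply/mem_set; exists (gdist adj v w - n)%N => //=; rewrite subnK.
- apply/trivIsetP => i j _ _ ij; apply/seteqP; split=> // w /= [-> /eqP].
  by rewrite eqn_add2r (negPf ij).
- exact: p0.
Qed.

(** The supremum over the starting points of the probability of a step of
    length at least [n], as a real number. *)
Definition tail_bound n : R := fine (sup_step_tail adj p n).

Let tail_prob v n :
  0 <= markov_op p (fun w => (n <= gdist adj v w)%N%:R) v <= 1.
Proof.
by apply: markov_op_between => // w; case: leq; rewrite ?lexx ?ler01.
Qed.

Context (e : V).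

Let sup_tail_fin n : sup_step_tail adj p n \is a fin_num.
Proof.
rewrite ge0_fin_numE.
  apply: le_lt_trans (ltry 1); apply: ge_ereal_sup => _ [v _ <-].
  by rewrite step_tailE lee_fin; have /andP[] := tail_prob v n.
apply: le_trans (ereal_sup_ubound (x := step_tail adj p e n) _); last by exists e.
by rewrite step_tailE lee_fin; have /andP[] := tail_prob e n.
Qed.

Lemma tail_boundP v n :
  markov_op p (fun w => (n <= gdist adj v w)%N%:R) v <= tail_bound n.
Proof.
rewrite -lee_fin fineK ?sup_tail_fin// -step_tailE.
by apply: ereal_sup_ubound; exists v.
Qed.

Lemma tail_bound_ge0 n : 0 <= tail_bound n.
Proof.
by apply: le_trans (tail_boundP e n); have /andP[] := tail_prob e n.
Qed.

(** The sum of the tail probabilities also bounds the mean length of a step. *)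
Lemma tail_bound_bounded_sums : uniform_first_moment adj p ->
  bounded_sums (fun n => tail_bound n.+1).
Proof.
move=> pm; apply: (nneseries_bounded_sums (m := 1) tail_bound_ge0).
rewrite (eq_eseriesr (g := sup_step_tail adj p))// => n _.
by rewrite fineK// sup_tail_fin.
Qed.

End step_length.

Section walk.
Context (R : realType) (V : choiceType) (adj : rel V) (e : V).
Context (p : V -> V -> R).
Hypothesis adj_conn : connected_graph adj.
Hypothesis adj_sym : symmetric adj.
Hypothesis p_trans : transition_matrix p.
Hypothesis p_moment : uniform_first_moment adj p.

Let norm v := gdist adj e v.

(** From a point [v] far away, either the step is long, which is unlikely, or it
    ends far away, where [u] is small. *)
Lemma markov_op_vanishing u : sup_bounded u -> vanishing norm u ->
  vanishing norm (markov_op p u).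
Proof.
move=> ub uv eps eps0; have [M uM] := ub.
have M0 : 0 <= M := le_trans (normr_ge0 _) (uM e).
have eps2 : 0 < eps / 2 by rewrite divr_gt0.
have [r ur] := uv _ eps2.
(* [M] may be zero, hence the division by [M + 1]. *)
have M1 : 0 < M + 1 by lra.
have [N phiN] := bounded_sums_small (fun n => tail_bound_ge0 adj p_trans e n.+1)
  (tail_bound_bounded_sums p_trans e p_moment) (divr_gt0 eps2 M1).
exists (r + N.+1)%N => v rv.
pose far w : R := (N.+1 <= gdist adj v w)%N%:R.
have farb : sup_bounded far := sup_bounded_bool R (fun w => N < gdist adj v w)%N.
have u_le w : `|u w| <= eps / 2 + M * far w.
  rewrite /far; case: ltnP => vw; first by rewrite mulr1; have := uM w; lra.
  rewrite mulr0 addr0 ur// -(ltn_add2r (gdist adj v w)).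
  rewrite [X in (_ < _ + X)%N](gdist_sym adj_conn adj_sym).
  apply: leq_trans (gdist_triangle adj_conn e w v).
  by rewrite (leq_trans _ rv)// ltnS leq_add2l (leq_trans vw).
have bb : sup_bounded (fun w => eps / 2 + M * far w).
  by apply: sup_boundedD; [exact: sup_bounded_cst | exact: sup_boundedZ].
have Pb : markov_op p (fun w => eps / 2 + M * far w) v <= eps.
  rewrite markov_opD//; [|exact: sup_bounded_cst | exact: sup_boundedZ].
  rewrite markov_op_cst// markov_opZ//.
  have : markov_op p far v <= eps / 2 / (M + 1).
    exact: le_trans (tail_boundP adj p_trans e v N.+1) (phiN N (leqnn N)).
  rewrite ler_pdivlMr// => far_le.
  have := markov_op_ge0 p_trans v (fun w => ler0n R _) farb.
  rewrite -/far; nra.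
rewrite ler_norml; apply/andP; split.
  rewrite lerNl -markov_opN//; apply: le_trans Pb.
  apply: le_markov_op => //; first exact: sup_boundedN.
  by move=> w; rewrite (le_trans _ (u_le w))// -normrN ler_norm.
apply: le_trans Pb; apply: le_markov_op => // w.
by rewrite (le_trans _ (u_le w))// ler_norm.
Qed.

Lemma markov_iter_vanishing n u : sup_bounded u -> vanishing norm u ->
  vanishing norm (markov_iter p n u).
Proof.
move=> ub uv; elim: n => //= n IHn.
by apply: markov_op_vanishing => //; exact: markov_iter_bounded.
Qed.

End walk.

(** * The walk leaves balls at linear speed *)

Section escape.
Context (R : realType) (V : choiceType) (norm : V -> nat) (p : V -> V -> R).
Hypothesis p_trans : transition_matrix p.
Context (C rho : R) (D : nat).
Hypothesis C0 : 0 < C.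
Hypothesis D0 : (0 < D)%N.
Hypothesis p_bound : forall v w n, (ptrans p n v w <= (C * rho ^+ n)%:E)%E.
Hypothesis norm_ball : forall r, exists2 s : seq V,
  forall v, (norm v <= r)%N -> v \in s & (size s <= D ^ r)%N.

Lemma rho_ge0 (e : V) : 0 <= rho.
Proof.
have := p_bound e e 1; rewrite expr1 -(pmulr_rge0 _ C0) -lee_fin; apply: le_trans.
rewrite ptransE// lee_fin; apply: markov_op_ge0 => //.
exact: (sup_bounded_bool R (fun x => x == e)).
Qed.

(** The ball of radius [r] has at most [D ^ r] elements, each of which is
    reached at time [n] with probability at most [C * rho ^ n]. *)
Lemma markov_iter_ball n r v :
  markov_iter p n (fun w => (norm w <= r)%N%:R) v <= C * rho ^+ n * D%:R ^+ r.
Proof.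
have [s sP sD] := norm_ball r.
have indb w : sup_bounded (fun x => (x == w)%:R : R) :=
  sup_bounded_bool R (fun x => x == w).
have rn0 := exprn_ge0 n (rho_ge0 v).
apply: (@le_trans _ _ (\sum_(w <- s) C * rho ^+ n)); last first.
  rewrite big_const_seq count_predT iter_addr_0 -[leLHS]mulr_natr.
  apply: ler_wpM2l; first by rewrite mulr_ge0// ltW.
  by rewrite -natrX ler_nat.
apply: (@le_trans _ _ (\sum_(w <- s) markov_iter p n (fun x => (x == w)%:R) v)).
  rewrite -markov_iter_sum//; apply: le_markov_iter => //.
  - exact: (sup_bounded_bool R (fun w => norm w <= r)%N).
  - exact: sup_bounded_sum.
  move=> x; case: leqP => [/sP xs|_]; last by rewrite sumr_ge0.
  rewrite (big_rem x xs)/= eqxx lerDl sumr_ge0//.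
by apply: ler_sum => w _; rewrite -lee_fin -ptransE.
Qed.

Hypothesis rho_lt1 : rho < 1.

(** For [q] so large that [D ^ 2 * rho ^ q <= 1 / 2], the probability
    [C * rho ^ n * D ^ r] decays geometrically in [n / q] when
    [r = 2 (n / q + 1)]. *)
Lemma escape_rate : exists2 q, (0 < q)%N &
  forall n v, let j := (n %/ q).+1 in
    markov_iter p n (fun w => (norm w <= j + j)%N%:R) v <=
      C * D%:R ^+ 2 * 2^-1 ^+ (n %/ q).
Proof.
have [[e]|noV] := pselect (inhabited V); last first.
  by exists 1%N => // n v; exfalso; apply: noV; exists.
have r0 := rho_ge0 e.
have D1 : 1 <= D%:R :> R by rewrite ler1n.
have D20 : 0 < D%:R ^+ 2 :> R by rewrite exprn_gt0// ltr0n.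
have [q q0 qP] : exists2 q, (0 < q)%N & D%:R ^+ 2 * rho ^+ q <= 2^-1.
  have eps0 : 0 < 2^-1 / D%:R ^+ 2 :> R by rewrite divr_gt0.
  have rho_cvg : (fun n => rho ^+ n) @ \oo --> (0 : R^o).
    by apply: cvg_expr; rewrite ger0_norm.
  have /cvgrPdist_le/(_ _ eps0)[N _ NP] := rho_cvg.
  exists N.+1 => //; have := NP N.+1 (leqnSn N).
  rewrite sub0r normrN ger0_norm ?exprn_ge0// ler_pdivlMr//.
  by rewrite mulrC.
exists q => // n v /=; set j := (n %/ q)%N.
apply: le_trans (markov_iter_ball n _ v) _.
rewrite -[leLHS]mulrA -[leRHS]mulrA ler_wpM2l// ?(ltW C0)//.
rewrite addnn -mul2n exprM (exprS (D%:R ^+ 2) j) mulrCA.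
rewrite ler_wpM2l//.
rewrite [in rho ^+ n](divn_eq n q) -/j exprD mulnC exprM mulrAC -exprMn.
rewrite -[leRHS]mulr1 ler_pM//.
- by rewrite exprn_ge0// mulr_ge0// exprn_ge0.
- by rewrite exprn_ge0.
- rewrite lerXn2r// ?nnegrE// ?mulr_ge0 ?exprn_ge0//; last by rewrite mulrC.
- by rewrite exprn_ile1// ltW.
Qed.

End escape.

(** * The mean Floyd distance covered in one step *)

Section drift.
Context (R : realType) (V : choiceType) (adj : rel V) (e : V) (f : nat -> R).
Context (p : V -> V -> R) (X : metricType R) (iota : V -> X).
Hypothesis adj_conn : connected_graph adj.
Hypothesis adj_sym : symmetric adj.
Hypothesis f_floyd : floyd_function f.
Hypothesis p_trans : transition_matrix p.
Let df := floyd_dist adj e f.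
Let norm v := gdist adj e v.
Let phi := tail_bound adj p.
Hypothesis iota_isom : forall v w, mdist (iota v) (iota w) = df v w.

(** The mean Floyd distance covered by a step of the walk from [v]. *)
Definition drift v := markov_op p (floyd_dist adj e f v) v.

Context (M : R).
Hypothesis df_le : forall v w, df v w <= M.

Let df_ge0 v w : 0 <= df v w. Proof. by rewrite -iota_isom mdist_ge0. Qed.

Let df_bounded v : sup_bounded (df v).
Proof. by apply: (@sup_boundedP _ _ _ 0 M) => w; rewrite df_ge0 df_le. Qed.

Lemma drift_between v : 0 <= drift v <= M.
Proof. by apply: markov_op_between => // w; rewrite df_ge0 df_le. Qed.

Lemma drift_bounded : sup_bounded drift.
Proof. exact: sup_boundedP drift_between. Qed.

Let sum_lt_nat j k : (k <= j)%N -> k%:R <= \sum_(0 <= i < j) (i < k)%N%:R :> R.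
Proof.
move=> kj; rewrite (big_cat_nat (leq0n k) kj)/= -[leLHS]addr0 lerD//.
  rewrite (eq_big_nat _ _ (F2 := fun=> 1)) => [|i /andP[_ ->]//].
  by rewrite sumr_const_nat subn0.
exact: sumr_ge0.
Qed.

Context (S : R).
Hypothesis phi_sum : forall n, \sum_(0 <= i < n) phi i.+1 <= S.

(** A step of length at least [j] covers a Floyd distance at most [M].  A
    shorter one is realized by edges of Floyd length at most [f j], and the mean
    length of a step is at most [S]. *)
Lemma drift_le j v : (0 < j)%N -> (j + j <= norm v)%N ->
  drift v <= M * phi j + S * f j.
Proof.
move=> j0 jv; pose long i w : R := (i <= gdist adj v w)%N%:R.
have longb i : sup_bounded (long i) :=
  sup_bounded_bool R (fun w => i <= gdist adj v w)%N.
have M0 : 0 <= M := le_trans (df_ge0 e e) (df_le e e).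
have f0 := ltW (floyd_fun_gt0 f_floyd j).
have sumb : sup_bounded (fun w => \sum_(0 <= i < j) long i.+1 w).
  exact: sup_bounded_sum.
apply: (@le_trans _ _ (markov_op p
    (fun w => M * long j w + f j * \sum_(0 <= i < j) long i.+1 w) v)).
  apply: le_markov_op => //; first by apply: sup_boundedD; exact: sup_boundedZ.
  move=> w; rewrite /long; case: (leqP j) => [jw|wj].
    rewrite mulr1 -[leLHS]addr0 lerD ?df_le// mulr_ge0// sumr_ge0//.
  rewrite mulr0 add0r.
  apply: le_trans (floyd_dist_far adj_conn adj_sym f_floyd j0 _) _.
    by rewrite (leq_trans _ jv)// leq_add2l ltnW.
  by rewrite -mulr_natr ler_wpM2l//; exact: sum_lt_nat (ltnW wj).
rewrite markov_opD//; [|exact: sup_boundedZ|exact: sup_boundedZ].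
rewrite !markov_opZ// lerD//.
  by rewrite ler_wpM2l//; exact: (tail_boundP adj p_trans e v j).
rewrite mulrC ler_wpM2r// markov_op_sum//; apply: le_trans (phi_sum j).
by apply: ler_sum => i _; exact: (tail_boundP adj p_trans e v i.+1).
Qed.

(* The bound of [drift_le] for the positive radius [j.+1]. *)
Let B j : R := M * phi j.+1 + S * f j.+1.

Let phi_ge0 j : 0 <= phi j. Proof. exact: tail_bound_ge0. Qed.

Let S_ge0 : 0 <= S. Proof. by have := phi_sum 0; rewrite big_geq. Qed.

Let M_ge0 : 0 <= M. Proof. exact: le_trans (df_ge0 e e) (df_le e e). Qed.

Let B_ge0 j : 0 <= B j.
Proof. by rewrite addr_ge0// mulr_ge0// ltW// floyd_fun_gt0. Qed.

Let B_sums : bounded_sums B.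
Proof.
apply: bounded_sumsD; apply: bounded_sumsZ => //; first by exists S.
have [T fT] := floyd_fun_bounded_sums f_floyd; exists T => n.
apply: le_trans (fT n.+1); rewrite [leRHS]big_nat_recl//=.
by rewrite lerDr ltW// floyd_fun_gt0.
Qed.

Lemma drift_vanishing : vanishing norm drift.
Proof.
move=> eps /(bounded_sums_small B_ge0 B_sums)[N BN].
exists (N.+1 + N.+1)%N => v /ltnW vN; have /andP[d0 _] := drift_between v.
rewrite ger0_norm//; apply: le_trans (BN N (leqnn N)).
exact: drift_le.
Qed.

(** [markov_iter p n drift v] is the mean Floyd distance covered by the step at
    time [n] of the walk started at [v]; it is summable in [n] uniformly in [v].
    At time [n] the walk is either within distance [2 (n / q + 1)] of [e], which
    is exponentially unlikely, or at a point where [drift_le] applies. *)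
Lemma drift_summable C rho D : 0 < C -> rho < 1 -> (0 < D)%N ->
    (forall v w n, (ptrans p n v w <= (C * rho ^+ n)%:E)%E) ->
    (forall r, exists2 s : seq V,
       forall v, (norm v <= r)%N -> v \in s & (size s <= D ^ r)%N) ->
  exists b : nat -> R, [/\ forall n, 0 <= b n, bounded_sums b &
    forall n v, markov_iter p n drift v <= b n].
Proof.
move=> C0 rho1 D0 p_bound balls.
have [q q0 qP] := escape_rate p_trans C0 D0 p_bound balls rho1.
pose a j := M * (C * D%:R ^+ 2) * 2^-1 ^+ j + B j.
have K0 : 0 <= M * (C * D%:R ^+ 2) by rewrite !mulr_ge0// ltW.
have a0 j : 0 <= a j by rewrite addr_ge0// mulr_ge0// exprn_ge0.
exists (fun n => a (n %/ q)%N); split=> [//||n v].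
  apply: bounded_sums_divn => //; apply: bounded_sumsD => //.
  by apply: bounded_sumsZ => //; exact: bounded_sums_half.
have := qP n v => /=; set j := (n %/ q)%N => near_le.
pose near w : R := (norm w <= j.+1 + j.+1)%N%:R.
have nearb : sup_bounded near :=
  sup_bounded_bool R (fun w => norm w <= j.+1 + j.+1)%N.
apply: (@le_trans _ _ (markov_iter p n (fun w => M * near w + B j) v)).
  apply: le_markov_iter => //; first exact: drift_bounded.
    by apply: sup_boundedD; [exact: sup_boundedZ | exact: sup_bounded_cst].
  move=> w; rewrite /near; have /andP[_ dM] := drift_between w.
  case: leqP => [_|/ltnW jw]; first by rewrite mulr1 (le_trans dM)// lerDl.
  by rewrite mulr0 add0r drift_le.
rewrite markov_iterD//; [|exact: sup_boundedZ|exact: sup_bounded_cst].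
by rewrite markov_iter_cst// markov_iterZ// /a lerD2r -mulrA ler_wpM2l.
Qed.

End drift.

(** * Harmonic functions with prescribed boundary values *)

Section boundary_values.
Context (R : realType) (V : choiceType) (adj : rel V) (e : V) (f : nat -> R).
Context (p : V -> V -> R) (X : metricType R) (iota : V -> X).
Hypothesis p_trans : transition_matrix p.
Let df := floyd_dist adj e f.
Let norm v := gdist adj e v.
Let delta := drift adj e f p.
Hypothesis iota_isom : forall v w, mdist (iota v) (iota w) = df v w.

Context (M : R) (b : nat -> R).
Hypothesis df_le : forall v w, df v w <= M.
Hypothesis delta_vanishing : forall n, vanishing norm (markov_iter p n delta).
Hypothesis b_ge0 : forall n, 0 <= b n.
Hypothesis b_sums : bounded_sums b.
Hypothesis delta_le : forall n v, markov_iter p n delta v <= b n.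

Let df_bounded v : sup_bounded (df v).
Proof.
by apply: (@sup_boundedP _ _ _ 0 M) => w; rewrite -iota_isom mdist_ge0 iota_isom df_le.
Qed.

Let delta_bounded : sup_bounded delta.
Proof. exact: (drift_bounded p_trans iota_isom df_le). Qed.

Section lipschitz.
Context (G : V -> R) (L : R).
Hypothesis G_bounded : sup_bounded G.
Hypothesis L_ge0 : 0 <= L.
Hypothesis G_lip : forall v w, `|G v - G w| <= L * df v w.

Lemma markov_step_lipschitz v : `|markov_op p G v - G v| <= L * delta v.
Proof.
have up : markov_op p (fun w => G w - G v) v <= L * delta v.
  rewrite /delta /drift -markov_opZ//; apply: le_markov_op => //.
  - by apply: sup_boundedB => //; exact: sup_bounded_cst.
  - exact: sup_boundedZ.
  - by move=> w; have := G_lip v w; rewrite /df ler_norml; lra.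
have down : markov_op p (fun w => G v - G w) v <= L * delta v.
  rewrite /delta /drift -markov_opZ//; apply: le_markov_op => //.
  - by apply: sup_boundedB => //; exact: sup_bounded_cst.
  - exact: sup_boundedZ.
  - by move=> w; have := G_lip v w; rewrite /df ler_norml; lra.
have cb := @sup_bounded_cst R V (G v).
rewrite markov_opB// markov_op_cst// in up.
rewrite markov_opB// markov_op_cst// in down.
by rewrite ler_norml; lra.
Qed.

Lemma markov_iter_step_lipschitz n v :
  `|markov_iter p n.+1 G v - markov_iter p n G v| <= L * markov_iter p n delta v.
Proof.
have PGb := markov_op_bounded p_trans G_bounded.
have -> : markov_iter p n.+1 G = markov_iter p n (markov_op p G).
  by rewrite /markov_iter iterSr.
have Ldb := sup_boundedZ L delta_bounded.
rewrite -markov_iterB// -markov_iterZ// ler_norml; apply/andP; split.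
  rewrite lerNl -[leLHS]sub0r -[X in X - _](markov_iter_cst p_trans n 0 v).
  rewrite -markov_iterB//; [|exact: sup_bounded_cst|exact: sup_boundedB].
  apply: le_markov_iter => //.
    by apply: sup_boundedB; [exact: sup_bounded_cst|exact: sup_boundedB].
  by move=> w; have := markov_step_lipschitz w; rewrite ler_norml; lra.
apply: le_markov_iter => //; first exact: sup_boundedB.
by move=> w; have := markov_step_lipschitz w; rewrite ler_norml; lra.
Qed.

Lemma markov_iter_lipschitz_cauchy n k v :
  `|markov_iter p (n + k) G v - markov_iter p n G v| <=
    L * \sum_(n <= i < n + k) b i.
Proof.
elim: k => [|k IHk]; first by rewrite addn0 subrr normr0 big_geq// mulr0.
rewrite addnS big_nat_recr ?leq_addr//= mulrDr.
apply: le_trans (ler_distD (markov_iter p (n + k) G v) _ _) _.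
rewrite addrC lerD//; apply: le_trans (markov_iter_step_lipschitz (n + k) v) _.
by rewrite ler_wpM2l.
Qed.

Lemma markov_iter_lipschitz_vanishing n :
  vanishing norm (fun v => markov_iter p n G v - G v).
Proof.
elim: n => [|n IHn].
  by move=> eps eps0; exists 0%N => v _; rewrite subrr normr0 ltW.
apply: vanishing_le (vanishingD (vanishingZ L (delta_vanishing n))
  (vanishing_norm IHn)) => v.
have Pd0 : 0 <= markov_iter p n delta v.
  suff /andP[] : 0 <= markov_iter p n delta v <= M by [].
  apply: markov_iter_between => // w.
  exact: (drift_between p_trans iota_isom df_le).
rewrite [leRHS]ger0_norm ?addr_ge0 ?mulr_ge0//.
apply: le_trans (ler_distD (markov_iter p n G v) _ _) _.
by rewrite lerD2r; exact: markov_iter_step_lipschitz.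
Qed.

End lipschitz.

Hypothesis X_compact : compact [set: X].
Context (F : X -> R).
Hypothesis F_cont : continuous F.

Let u v := F (iota v).

Lemma sup_bounded_comp (G : X -> R) :
  (exists2 N, 0 < N & forall x, `|G x| <= N) -> sup_bounded (G \o iota).
Proof. by move=> [N _ GN]; exists N => v; exact: GN. Qed.

Let u_bounded : sup_bounded u.
Proof. exact/sup_bounded_comp/compact_continuous_bounded. Qed.

Let u_lipschitz eps : 0 < eps -> exists2 L, 0 <= L & exists G : V -> R,
  [/\ sup_bounded G, forall v w, `|G v - G w| <= L * df v w &
      forall v, `|u v - G v| <= eps].
Proof.
move=> eps0; have [L L0 [G [GL FG]]] := lipschitz_approximation X_compact F_cont eps0.
exists L => //; exists (G \o iota); split=> [|v w|v]; last exact: FG.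
  have [N uN] := u_bounded; exists (N + eps) => v.
  by have := uN v; have := FG (iota v); rewrite /u !ler_norml/=; lra.
by rewrite -iota_isom; exact: GL.
Qed.

Lemma markov_iter_cauchy eps : 0 < eps -> exists N, forall m n v,
  (N <= m)%N -> (N <= n)%N ->
  `|markov_iter p m u v - markov_iter p n u v| <= eps.
Proof.
move=> eps0; have eps3 : 0 < eps / 3 by rewrite divr_gt0.
have [L L0 [G [Gb GL uG]]] := u_lipschitz eps3.
(* [L] may be zero, hence the division by [L + 1]. *)
have L1 : 0 < L + 1 by rewrite ltr_pwDr.
have [N bN] := bounded_sums_tail b_ge0 b_sums (divr_gt0 eps3 L1).
have le m n v : (N <= n)%N -> (n <= m)%N ->
    `|markov_iter p m u v - markov_iter p n u v| <= eps.
  move=> Nn /subnKC <-; set k := (m - n)%N.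
  have := markov_iter_lipschitz_cauchy Gb L0 GL n k v.
  have := bN n (n + k)%N Nn; rewrite ler_pdivlMr//.
  have := markov_iter_dist p_trans (n + k) v u_bounded Gb uG.
  have := markov_iter_dist p_trans n v u_bounded Gb uG.
  have : 0 <= \sum_(n <= i < n + k) b i by exact: sumr_ge0.
  rewrite !ler_norml; nra.
exists N => m n v Nm Nn; have [nm|/ltnW mn] := leqP n m; first exact: le.
by rewrite distrC; exact: le.
Qed.

Lemma markov_iter_sub_vanishing n :
  vanishing norm (fun v => markov_iter p n u v - u v).
Proof.
move=> eps eps0; have eps3 : 0 < eps / 3 by rewrite divr_gt0.
have [L L0 [G [Gb GL uG]]] := u_lipschitz eps3.
have [r rP] := markov_iter_lipschitz_vanishing Gb L0 GL n eps3.
exists r => v /rP; have := uG v.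
have := markov_iter_dist p_trans n v u_bounded Gb uG.
rewrite !ler_norml; lra.
Qed.

(** The harmonic function is the uniform limit of the iterates of [F]
    restricted to the vertices. *)
Lemma harmonic_asymptotic : exists2 h : V -> R, harmonic_on_graph p h &
  vanishing norm (fun v => h v - u v).
Proof.
have [h h_harm hP] := harmonic_limit p_trans u_bounded markov_iter_cauchy.
exists h => // eps eps0; have eps2 : 0 < eps / 2 by rewrite divr_gt0.
have [N NP] := hP _ eps2; have [r rP] := markov_iter_sub_vanishing N eps2.
exists r => v /rP; have := NP N v (leqnn N); rewrite !ler_norml; lra.
Qed.

End boundary_values.

(** * The Dirichlet problem *)

Theorem theorem3p4 (R : realType) (V : choiceType) (adj : rel V) (e : V)
    (adj_sym : symmetric adj)
    (adj_lf : locally_finite adj)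
    (adj_conn : connected_graph adj)
    (f : nat -> R)
    (f_floyd : floyd_function f)
    (f_moment : (\sum_(1 <= n <oo) (n%:R * f n)%:E < +oo)%E)
    (p : V -> V -> R)
    (p_trans : transition_matrix p)
    (p_irr : uniformly_irreducible adj p)
    (p_moment : uniform_first_moment adj p)
    (rho : R)
    (rhoE : spectral_radius p e e = rho%:E)
    (rho_lt1 : rho < 1)
    (p_bound : exists2 C : R, 0 < C &
       forall (v w : V) (n : nat), (ptrans p n v w <= (C * rho ^+ n)%:E)%E)
    (X : metricType R) (iota : V -> X)
    (X_floyd : floyd_compactification adj e f iota) :
  dirichlet_solvable p iota.
Proof.
have [iota_isom _ X_complete] := X_floyd.
have [C C0 pC] := p_bound.
have [D D0 degD] := bounded_degree adj_lf p_trans p_irr.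
have balls := ball_card_le adj_conn e D0 degD.
have norm_ball r : exists s : seq V, forall v, (gdist adj e v <= r)%N -> v \in s.
  by have [s sP _] := balls r; exists s.
have [M M0 df_le] := floyd_dist_bounded adj_conn f_floyd iota_isom.
have X_compact : compact [set: X].
  apply: compact_of_nets => // eps eps0.
  have eps2 : 0 < eps / 2 by rewrite divr_gt0.
  have [N NP] := floyd_dist_net adj_conn f_floyd iota_isom eps2.
  have [s sP] := norm_ball N; exists [seq iota v | v <- s] => x.
  (* The vertices are dense, so a net for them is one for the completion. *)
  have [v xv] := completion_dense X_floyd x eps2.
  have [u uN uv] := NP v; exists (iota u); first by rewrite map_f ?sP.
  apply: le_lt_trans (metric_triangle _ (iota v) _) _.
  by rewrite [eps]splitr ler_ltD// ?iota_isom// metric_sym.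
have [S phi_sum] := tail_bound_bounded_sums p_trans e p_moment.
have [b [b0 b_sums b_le]] := drift_summable adj_conn adj_sym f_floyd p_trans
  iota_isom df_le phi_sum C0 rho_lt1 D0 pC balls.
have d_van n : vanishing (gdist adj e) (markov_iter p n (drift adj e f p)).
  apply: markov_iter_vanishing => //.
    exact: (drift_bounded p_trans iota_isom df_le).
  exact: (drift_vanishing adj_conn adj_sym f_floyd p_trans iota_isom df_le phi_sum).
have isolated := floyd_dist_isolated e adj_conn f_floyd.
move=> phi phi_cont.
have [F [F_cont Fphi]] :=
  compact_tietze X_compact (boundary_closed X_floyd isolated) phi_cont.
have [h h_harm hF] := harmonic_asymptotic p_trans iota_isom df_le d_van b0
  b_sums b_le X_compact F_cont.
have [H [H_cont Hh HF]] :=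
  continuous_extension X_floyd isolated norm_ball F_cont hF.
exists H; split=> // [x xN|]; first by rewrite HF// Fphi.
by rewrite (_ : H \o iota = h)//; apply/funext.
Qed.
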